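(* Let $\alpha,\beta$ be positive real numbers. The BCF expansion of $(\alpha,\beta)$ is the only proper BCF representation of $(\alpha,\beta)$.
   Context: BCF (bifurcating continued fraction) expansion: for an ordered pair $(\alpha,\beta)$ of positive real numbers, put $\alpha_0=\alpha$, $\beta_0=\beta$ and, successively for $i=0,1,2,\ldots$, $a_i=\operatorname{int}(\alpha_i)$, $b_i=\operatorname{int}(\beta_i)$, $\alpha_{i+1}=1/(\beta_i-b_i)$, $\beta_{i+1}=(\alpha_i-a_i)/(\beta_i-b_i)$, where $\operatorname{int}$ denotes the integer part. The ordered pair of integer sequences $(\{a_0,a_1,\ldots,a_i,\ldots\},\{b_0,b_1,\ldots,b_i,\ldots\})$ so obtained is called the BCF expansion of $(\alpha,\beta)$. The algorithm is undefined if $\beta_i$ becomes an integer for some $i=n$; in this case the BCF expansion of $(\alpha,\beta)$ is said to be finite and is given by the ordered pair of finite sequences $(\{a_0,a_1,\ldots,a_{n-1},\alpha_n\},\{b_0,b_1,\ldots,b_n\})$, where the $a_i,b_i$ are integers and $\alpha_n$ is real. Fibonacci Tree sum: for non-negative integers $a_i,b_i$ and positive reals $x,y$, the ordered pair of real numbers $[\{a_0,\ldots,a_{n-1},x\},\{b_0,\ldots,b_{n-1},y\}]$ is defined by the recurrence $[\{a_0,\ldots,a_{n-1},x\},\{b_0,\ldots,b_{n-1},y\}]=[\{a_0,\ldots,a_{n-2},a_{n-1}+(y/x)\},\{b_0,\ldots,b_{n-2},b_{n-1}+(1/x)\}]$ for $n\ge 1$, with the terminating condition $[\{x\},\{y\}]=(x,y)$.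 Proper BCF representation: an ordered pair of non-negative integer sequences $(\{a_0,a_1,\ldots,a_i,\ldots\},\{b_0,b_1,\ldots,b_i,\ldots\})$ is called a proper BCF representation of $(\alpha,\beta)$, where $\alpha,\beta$ are positive real numbers, if for every $n$ there exist positive reals $\alpha_n$ and $\beta_n$ such that $(\alpha,\beta)=[\{a_0,a_1,\ldots,a_{n-1},\alpha_n\},\{b_0,b_1,\ldots,b_{n-1},\beta_n\}]$, and $\alpha_n>1$ and $\alpha_n>\beta_n$ for all $n\ge 1$.
   Formalization: ''Proper'' is extended to finite pairs (n = 0,…,N, last entries α_N, β_N = b_N), with the last β_N allowed to be 0; otherwise the claim fails, e.g. for (2, 3/2), whose expansion is ({2,2},{1,0}). Finite and infinite pairs both compete in uniqueness. *)

(* Defs.v *)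
From HB Require Import structures.
From mathcomp Require Import all_boot all_order all_algebra.
From mathcomp Require Import boolp reals.

Set Implicit Arguments.
Unset Strict Implicit.
Unset Printing Implicit Defensive.

Import Order.TTheory GRing.Theory Num.Theory.

Local Open Scope ring_scope.

(* The two shapes of an ordered pair of sequences:
   [BCFInf a b]   is ({a_0, a_1, ...}, {b_0, b_1, ...});
   [BCFFin a x b] is ({a_0, ..., a_{N-1}, x}, {b_0, ..., b_N}), N = size a. *)
Inductive bcf_pair (R : Type) : Type :=
| BCFInf (a b : nat -> int)
| BCFFin (a : seq int) (x : R) (b : seq int).

Arguments BCFInf {R} a b.
Arguments BCFFin {R} a x b.

Definition bcf_step (R : realType) (p : R * R) : R * R :=
  let a := Num.floor p.1 in
  let b := Num.floor p.2 in
  (1 / (p.2 - b%:~R), (p.1 - a%:~R) / (p.2 - b%:~R)).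

(* The n-th pair (alpha_n, beta_n). It is the pair of the algorithm only as
   long as no beta_i with i < n is an integer; later values are junk, and
   [bcf_expansion] does not use them. *)
Definition bcf_iter (R : realType) (alpha beta : R) (n : nat) : R * R :=
  iter n (@bcf_step R) (alpha, beta).

Definition bcf_a (R : realType) (alpha beta : R) (n : nat) : int :=
  Num.floor (bcf_iter alpha beta n).1.

Definition bcf_b (R : realType) (alpha beta : R) (n : nat) : int :=
  Num.floor (bcf_iter alpha beta n).2.

Definition bcf_stops (R : realType) (alpha beta : R) (n : nat) : bool :=
  (bcf_iter alpha beta n).2 \is a Num.int.

Definition bcf_expansion (R : realType) (alpha beta : R) : bcf_pair R :=
  match pselect (exists n, bcf_stops alpha beta n) with
  | left stops =>
      let N := ex_minn stops in
      BCFFin (mkseq (bcf_a alpha beta) N)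
             (bcf_iter alpha beta N).1
             (mkseq (bcf_b alpha beta) N.+1)
  | right _ => BCFInf (bcf_a alpha beta) (bcf_b alpha beta)
  end.

(* [{a_0, ..., a_{n-1}, x}, {b_0, ..., b_{n-1}, y}]; only the first n terms
   of a and b matter. *)
Fixpoint fibonacci_tree_sum (R : realType) (a b : nat -> int) (n : nat)
    (x y : R) : R * R :=
  if n is m.+1 then
    fibonacci_tree_sum a b m ((a m)%:~R + y / x) ((b m)%:~R + 1 / x)
  else (x, y).

(* In a finite pair n ranges over 0, ..., N, and the last entries x and b_N
   are alpha_N and beta_N themselves. Since b_N is a non-negative integer,
   beta_N is allowed to vanish: this does occur in expansions, e.g. that of
   (2, 3/2), which is ({2, 2}, {1, 0}). *)
Definition proper_bcf_rep (R : realType) (e : bcf_pair R) (alpha beta : R) :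
    Prop :=
  match e with
  | BCFInf a b =>
      [/\ forall i, 0 <= a i,
          forall i, 0 <= b i
        & forall n, exists alpha_n beta_n : R,
            [/\ 0 < alpha_n,
                0 < beta_n,
                (alpha, beta) = fibonacci_tree_sum a b n alpha_n beta_n
              & (1 <= n)%N -> 1 < alpha_n /\ beta_n < alpha_n]]
  | BCFFin a x b =>
      let N := size a in
      [/\ size b = N.+1,
          forall i, (i < N)%N -> 0 <= nth 0 a i,
          forall i, (i <= N)%N -> 0 <= nth 0 b i
        & forall n, (n <= N)%N -> exists alpha_n beta_n : R,
            [/\ 0 < alpha_n,
                (n < N)%N -> 0 < beta_n,
                (alpha, beta) =
                  fibonacci_tree_sum (nth 0 a) (nth 0 b) n alpha_n beta_n,
                (1 <= n)%N -> 1 < alpha_n /\ beta_n < alpha_n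
              & n = N -> alpha_n = x /\ beta_n = (nth 0 b N)%:~R]]
  end.

(* Main.v *)
(* The map (x, y) |-> (a + y/x, b + 1/x) is injective, so a pair of digit
   sequences admits at most one complete quotient (alpha_n, beta_n) for each n,
   and these are linked by alpha_n = a_n + beta_{n+1}/alpha_{n+1} and
   beta_n = b_n + 1/alpha_{n+1}. Since 0 <= beta_{n+1} < alpha_{n+1} and
   1 < alpha_{n+1}, this forces a_n and b_n to be the integer parts of alpha_n
   and beta_n, forbids beta_n to be an integer, and makes
   (alpha_{n+1}, beta_{n+1}) the image of (alpha_n, beta_n) under the
   algorithm. *)
Require Import Defs.
From HB Require Import structures.
From mathcomp Require Import all_boot all_order all_algebra.
From mathcomp Require Import boolp reals.

Set Implicit Arguments.
Unset Strict Implicit.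
Unset Printing Implicit Defensive.

Import Order.TTheory GRing.Theory Num.Theory.

Local Open Scope ring_scope.

Section FibonacciTreeSum.
Variable R : realType.
Implicit Types (a b : nat -> int) (x y alpha beta : R).

Lemma eq_fibonacci_tree_sum a b a' b' n x y :
  (forall i, (i < n)%N -> a i = a' i) -> (forall i, (i < n)%N -> b i = b' i) ->
  fibonacci_tree_sum a b n x y = fibonacci_tree_sum a' b' n x y.
Proof.
elim: n x y => //= n IHn x y eqa eqb.
by rewrite eqa // eqb // IHn // => i lt_in; rewrite (eqa, eqb) // ltnW.
Qed.

(* One side needs no positivity: [1 / x] is injective even at the junk value
   [x = 0]. *)
Lemma fibonacci_tree_sum_inj a b n x y x' y' :
  (forall i, (i < n)%N -> 0 <= a i) -> (forall i, (i < n)%N -> 0 <= b i) ->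
  0 < x' -> 0 < y' ->
  fibonacci_tree_sum a b n x y = fibonacci_tree_sum a b n x' y' ->
  x = x' /\ y = y'.
Proof.
elim: n x y x' y' => [|n IHn] x y x' y' a_ge0 b_ge0 x'_gt0 y'_gt0 eq_sum.
  by case: eq_sum.
have [|||||eqa eqb] := IHn ((a n)%:~R + y / x) ((b n)%:~R + 1 / x)
  ((a n)%:~R + y' / x') ((b n)%:~R + 1 / x').
- by move=> i lt_in; apply/a_ge0/ltnW.
- by move=> i lt_in; apply/b_ge0/ltnW.
- by rewrite ltr_wpDl ?divr_gt0 ?ler0z ?a_ge0.
- by rewrite ltr_wpDl ?divr_gt0 ?ler0z ?b_ge0.
- exact: eq_sum.
move/addrI: eqb; rewrite !div1r => /invr_inj eqx.
move/addrI: eqa; rewrite eqx => /(mulIf _) -> //.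
by rewrite invr_eq0 gt_eqF.
Qed.

(** The bounds put [y / x] in [0, 1) and [1 / x] in (0, 1), so these are the fractional parts. The
    second one is nonzero, and inverting it recovers [x], then [y]. *)
Lemma bcf_step_inv (a b : int) x y : 1 < x -> 0 <= y < x ->
  [/\ Num.floor (a%:~R + y / x) = a,
      Num.floor (b%:~R + 1 / x) = b,
      b%:~R + 1 / x \isn't a Num.int
    & bcf_step (a%:~R + y / x, b%:~R + 1 / x) = (x, y)].
Proof.
move=> x_gt1 /andP[y_ge0 lt_yx].
have x_gt0 : 0 < x by apply: lt_trans x_gt1.
have x_neq0 : x != 0 by rewrite gt_eqF.
have floora : Num.floor (a%:~R + y / x) = a.
  apply: floor_def; rewrite lerDl divr_ge0 ?(ltW x_gt0) //=.
  by rewrite intrD ltrD2l ltr_pdivrMr // mul1r.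
have floorb : Num.floor (b%:~R + 1 / x) = b.
  apply: floor_def; rewrite lerDl divr_ge0 ?(ltW x_gt0) //=.
  by rewrite intrD ltrD2l ltr_pdivrMr // mul1r.
split=> //.
  by rewrite intrEfloor floorb eq_sym -subr_eq0 addrAC subrr add0r div1r
    invr_eq0.
rewrite /bcf_step /= floora floorb !(addrAC _ _ (- _)) !subrr !add0r.
by rewrite !div1r invrK divfK.
Qed.

(** Unfolding one level of the sum undoes one step of the algorithm: for x' = 1/{y} and y' =
    {x}/{y}, the quotient y'/x' is {x} and 1/x' is {y}, where {y} is nonzero since [y] is not an
    integer. *)
Lemma fibonacci_tree_sum_step x y a b n :
  y \isn't a Num.int -> a n = Num.floor x -> b n = Num.floor y ->
  fibonacci_tree_sum a b n.+1 (bcf_step (x, y)).1 (bcf_step (x, y)).2 =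
  fibonacci_tree_sum a b n x y.
Proof.
move=> y_nint an bn /=; rewrite an bn.
have fy_neq0 : y - (Num.floor y)%:~R != 0.
  by rewrite subr_eq0 eq_sym -intrEfloor.
by rewrite !div1r invrK divfK // !(addrC _%:~R) !subrK.
Qed.

End FibonacciTreeSum.

Section Expansion.
Variables (R : realType) (alpha beta : R).
Hypotheses (alpha_gt0 : 0 < alpha) (beta_gt0 : 0 < beta).

(** No induction: for positive [n] the last step alone gives the bounds, as it divides 1 and {x} by
    {y}, with {x} in [0, 1) and {y} in (0, 1). The second coordinate vanishes when {x} = 0. *)
Lemma bcf_iter_bounds n : (forall i, (i < n)%N -> ~~ bcf_stops alpha beta i) ->
  [/\ 0 < (bcf_iter alpha beta n).1,
      0 <= (bcf_iter alpha beta n).2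
    & (1 <= n)%N -> 1 < (bcf_iter alpha beta n).1 /\
        (bcf_iter alpha beta n).2 < (bcf_iter alpha beta n).1].
Proof.
case: n => [_|n nstops]; first by split=> //; apply: ltW.
have := nstops n (leqnn _); rewrite /bcf_stops /bcf_iter iterS.
case: (iter n _ _) => x y /= y_nint.
have fy_gt0 : 0 < y - (Num.floor y)%:~R.
  by rewrite subr_gt0 lt_neqAle -intrEfloor y_nint floor_le.
have fy_lt1 : y - (Num.floor y)%:~R < 1.
  by rewrite ltrBlDl -(intrD _ _ 1) floorD1_gt.
have fx_ge0 : 0 <= x - (Num.floor x)%:~R by rewrite subr_ge0 floor_le.
have fx_lt1 : x - (Num.floor x)%:~R < 1.
  by rewrite ltrBlDl -(intrD _ _ 1) floorD1_gt.
split; first by rewrite divr_gt0.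
  by rewrite divr_ge0 // ltW.
by move=> _; rewrite ltr_pM2r ?invr_gt0 // ltr_pdivlMr // mul1r.
Qed.

Lemma bcf_iter_gt0 n : (forall i, (i <= n)%N -> ~~ bcf_stops alpha beta i) ->
  0 < (bcf_iter alpha beta n).2.
Proof.
move=> nstops; have [|_ y_ge0 _] := @bcf_iter_bounds n.
  by move=> i /ltnW/nstops.
rewrite lt_neqAle y_ge0 andbT; apply: contraNneq (nstops n (leqnn n)) => y0.
by rewrite /bcf_stops -y0 rpred0.
Qed.

Lemma bcf_ab_ge0 n : (forall i, (i < n)%N -> ~~ bcf_stops alpha beta i) ->
  0 <= bcf_a alpha beta n /\ 0 <= bcf_b alpha beta n.
Proof. by case/bcf_iter_bounds=> /ltW; rewrite /bcf_a /bcf_b !floor_ge0. Qed.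

Lemma fibonacci_tree_sum_bcf_iter n :
  (forall i, (i < n)%N -> ~~ bcf_stops alpha beta i) ->
  (alpha, beta) = fibonacci_tree_sum (bcf_a alpha beta) (bcf_b alpha beta) n
    (bcf_iter alpha beta n).1 (bcf_iter alpha beta n).2.
Proof.
elim: n => // n IHn nstops.
rewrite [LHS]IHn => [|i lt_in]; last by apply/nstops/ltnW.
rewrite /bcf_iter iterS -/(bcf_iter alpha beta n).
rewrite [in RHS](surjective_pairing (bcf_iter _ _ _)).
by rewrite fibonacci_tree_sum_step // nstops.
Qed.

(** Core of uniqueness, shared by both shapes of representation. Allowing [y = 0] at level [n]
    covers the last pair of a finite one, while all pairs below [N] are positive. *)
Lemma complete_quotients_bcf_iter (a b : nat -> int) N n x y :
  (forall i, (i < N)%N -> 0 <= a i) -> (forall i, (i < N)%N -> 0 <= b i) ->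
  (forall m, (m < N)%N -> exists u v : R,
     [/\ 0 < u, 0 < v, (alpha, beta) = fibonacci_tree_sum a b m u v
       & (1 <= m)%N -> 1 < u /\ v < u]) ->
  (n <= N)%N -> 0 <= y -> (alpha, beta) = fibonacci_tree_sum a b n x y ->
  ((1 <= n)%N -> 1 < x /\ y < x) ->
  bcf_iter alpha beta n = (x, y) /\
  (forall i, (i < n)%N -> [/\ bcf_a alpha beta i = a i,
     bcf_b alpha beta i = b i & ~~ bcf_stops alpha beta i]).
Proof.
move=> a_ge0 b_ge0 cq; elim: n x y => [|n IHn] x y le_nN y_ge0 eq_sum xyP.
  by split=> //; rewrite /bcf_iter /= eq_sum.
have [u [v [u_gt0 v_gt0 eq_sum' uvP]]] := cq n le_nN.
have [iterE digits] := IHn u v (ltnW le_nN) (ltW v_gt0) eq_sum' uvP.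
have [x_gt1 lt_yx] := xyP isT.
(* Unfolded once, [eq_sum] is a sum of length [n] with the same value as [eq_sum']; injectivity
   applies with [u] and [v] on the positive side. *)
have uvE : (a n)%:~R + y / x = u /\ (b n)%:~R + 1 / x = v.
  apply: (@fibonacci_tree_sum_inj R a b n) => //.
  - by move=> i lt_in; apply: a_ge0; apply: leq_trans le_nN; apply: ltnW.
  - by move=> i lt_in; apply: b_ge0; apply: leq_trans le_nN; apply: ltnW.
  - by rewrite -eq_sum' eq_sum.
have [|fa fb nint step] := @bcf_step_inv R (a n) (b n) x y x_gt1.
  by rewrite y_ge0.
case: uvE => uE vE; rewrite uE vE in fa fb nint step.
split; first by rewrite /bcf_iter iterS -/(bcf_iter _ _ n) iterE.
move=> i; rewrite ltnS leq_eqVlt => /predU1P[->|/digits //].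
by rewrite /bcf_a /bcf_b /bcf_stops iterE.
Qed.

Lemma proper_bcf_expansion :
  proper_bcf_rep (bcf_expansion alpha beta) alpha beta.
Proof.
rewrite /bcf_expansion; case: pselect => [stops|nstops].
  case: ex_minnP => N stopsN minN.
  have nstops i : (i < N)%N -> ~~ bcf_stops alpha beta i.
    by rewrite ltnNge; apply/contra/minN.
  have nstops_le n : (n <= N)%N ->
      forall i, (i < n)%N -> ~~ bcf_stops alpha beta i.
    by move=> le_nN i lt_in; apply/nstops/(leq_trans lt_in).
  have aE i : (i < N)%N ->
      nth 0 (mkseq (bcf_a alpha beta) N) i = bcf_a alpha beta i.
    by move=> i_bound; rewrite nth_mkseq.
  have bE i : (i <= N)%N ->
      nth 0 (mkseq (bcf_b alpha beta) N.+1) i = bcf_b alpha beta i.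
    by move=> i_bound; rewrite nth_mkseq.
  rewrite /proper_bcf_rep !size_mkseq; split=> //.
  - move=> i lt_iN; rewrite aE //.
    by case: (bcf_ab_ge0 (nstops_le i (ltnW lt_iN))).
  - move=> i le_iN; rewrite bE //.
    by case: (bcf_ab_ge0 (nstops_le i le_iN)).
  move=> n le_nN; exists (bcf_iter alpha beta n).1, (bcf_iter alpha beta n).2.
  have [x_gt0 y_ge0 xyP] := bcf_iter_bounds (nstops_le n le_nN).
  split=> //.
  - move=> lt_nN; apply: bcf_iter_gt0 => i le_in.
    by apply: nstops; apply: leq_ltn_trans lt_nN.
  - rewrite [LHS](fibonacci_tree_sum_bcf_iter (nstops_le n le_nN)).
    apply: eq_fibonacci_tree_sum => i lt_in.
      by rewrite aE // (leq_trans lt_in).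
    by rewrite bE // ltnW // (leq_trans lt_in).
  (* At the stopping index the second coordinate is an integer, hence equal to its floor, the last
     digit. *)
  - move=> ->; split=> //; rewrite bE //; apply/esym/eqP.
    by rewrite -intrEfloor.
have {}nstops i : ~~ bcf_stops alpha beta i.
  by apply/negP => stops_i; apply: nstops; exists i.
split=> [i|i|n]; first by case: (@bcf_ab_ge0 i).
  by case: (@bcf_ab_ge0 i).
exists (bcf_iter alpha beta n).1, (bcf_iter alpha beta n).2.
have [//|x_gt0 _ xyP] := @bcf_iter_bounds n.
by split=> //; [apply: bcf_iter_gt0 | apply: fibonacci_tree_sum_bcf_iter].
Qed.

Lemma proper_bcf_rep_unique e :
  proper_bcf_rep e alpha beta -> e = bcf_expansion alpha beta.
Proof.
case: e => [a b [a_ge0 b_ge0 cq]|a x b [size_b a_ge0 b_ge0 cq]].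
  have digits i : [/\ bcf_a alpha beta i = a i, bcf_b alpha beta i = b i
                    & ~~ bcf_stops alpha beta i].
    (* The digits of index [i] are fixed by the complete quotient one level further. *)
    have [x [y [x_gt0 y_gt0 eq_sum xyP]]] := cq i.+1.
    have [|||||||_ digits] // := @complete_quotients_bcf_iter a b i.+1 i.+1 x y.
      exact: ltW.
    exact: digits.
  rewrite /bcf_expansion; case: pselect => [[n]|_].
    by move=> stops_n; have [_ _] := digits n; rewrite stops_n.
  by congr BCFInf; apply/funext => i; have [aE bE _] := digits i.
set N := size a in size_b a_ge0 b_ge0 cq.
have [x' [y' [x_gt0 _ eq_sum xyP /(_ erefl)[x'E y'E]]]] := cq N (leqnn N).
rewrite {}x'E {}y'E in x_gt0 eq_sum xyP.
have [iterE digits] : bcf_iter alpha beta N = (x, (nth 0 b N)%:~R) /\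
    (forall i, (i < N)%N -> [/\ bcf_a alpha beta i = nth 0 a i,
     bcf_b alpha beta i = nth 0 b i & ~~ bcf_stops alpha beta i]).
  apply: (@complete_quotients_bcf_iter _ _ N) => //.
  - by move=> i /ltnW; apply: b_ge0.
  - move=> m lt_mN.
    have [u [v [u_gt0 v_gt0 eq_sum' uvP _]]] := cq m (ltnW lt_mN).
    by exists u, v; split=> //; apply: v_gt0.
  - by rewrite ler0z b_ge0.
(* The last entry of [b] is an integer, so the algorithm stops at [N]; [digits] excludes any earlier
   stop, which makes [N] the minimal index [M]. *)
have stopsN : bcf_stops alpha beta N by rewrite /bcf_stops iterE /= intr_int.
rewrite /bcf_expansion; case: pselect => [stops|[]]; last by exists N.
case: ex_minnP => M stopsM minM.
have -> : M = N.
  apply/eqP; rewrite eqn_leq minM //= leqNgt; apply/negP => /digits[_ _].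
  by rewrite stopsM.
rewrite iterE; congr BCFFin.
  apply: (@eq_from_nth _ 0) => [|i lt_iN]; first by rewrite size_mkseq.
  by rewrite nth_mkseq //; have [-> _ _] := digits i lt_iN.
apply: (@eq_from_nth _ 0) => [|i]; first by rewrite size_mkseq.
rewrite size_b => lt_iN; rewrite nth_mkseq //.
(* The digit of index [N] lies beyond the reach of [digits]; it is read off [iterE] as the floor of
   an integer. *)
move: lt_iN; rewrite ltnS leq_eqVlt => /predU1P[->|/digits[_ -> //]].
by rewrite /bcf_b iterE /= intrKfloor.
Qed.

End Expansion.

Theorem lemma5 (R : realType) (alpha beta : R)
    (alpha_gt0 : 0 < alpha) (beta_gt0 : 0 < beta) :
  proper_bcf_rep (bcf_expansion alpha beta) alpha beta /\
  (forall e : bcf_pair R,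
     proper_bcf_rep e alpha beta -> e = bcf_expansion alpha beta).
Proof.
split; first exact: proper_bcf_expansion.
exact: proper_bcf_rep_unique.
Qed.
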